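(* A complemented subalgebra of the product of an uncountable family of Fréchet algebras is topologically isomorphic to a product of Fréchet algebras. More formally: let $T$ be an uncountable set, let $B_t$, $t\in T$, be Fréchet algebras, and let $X$ be a complemented subalgebra of the product $\prod\{B_t\colon t\in T\}$. Then $X$ is topologically isomorphic to a product $\prod\{F_j\colon j\in J\}$ of Fréchet algebras, where for each $j\in J$ the algebra $F_j$ is a complemented subalgebra of the product $\prod\{B_t\colon t\in T_j\}$ for some $T_j\subseteq T$ with $|T_j|=\omega$.
   Context: Algebras are over $\mathbb C$; homomorphisms are linear and multiplicative. A Fréchet algebra is a topological algebra topologically isomorphic to a closed subalgebra of a product of at most countably many Banach algebras (equivalently, a metrizable Arens–Michael algebra, an Arens–Michael algebra being a complete Hausdorff algebra whose topology is generated by a family of submultiplicative seminorms). Products carry the product topology and coordinatewise operations. A subalgebra $X$ of a topological algebra $B$ is complemented if there exists a continuous homomorphism $r\colon B\to X$ with $r(x)=x$ for each $x\in X$; ''$F$ is a complemented subalgebra of $B$'' is understood up to topological isomorphism. A topological isomorphism is an algebra isomorphism that is a homeomorphism. *)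

(* Defs.v *)
From HB Require Import structures.
From mathcomp Require Import all_boot all_order all_algebra.
From mathcomp Require Import all_classical all_reals all_analysis.

Set Implicit Arguments.
Unset Strict Implicit.
Unset Printing Implicit Defensive.

Import Order.TTheory GRing.Theory Num.Theory.
Import numFieldNormedType.Exports.

Local Open Scope classical_set_scope.
Local Open Scope ring_scope.

(* Associative algebras, without any unit: the ring structures of the library
   are all unital, whereas homomorphisms here are only linear and
   multiplicative. *)
HB.mixin Record Lmodule_hasAlgMul (K : numFieldType) A & GRing.Lmodule K A := {
  amul : A -> A -> A;
  amulA : associative amul;
  amulDl : left_distributive amul +%R;
  amulDr : right_distributive amul +%R;
  amulZl : forall (k : K) (x y : A), amul (k *: x) y = k *: amul x y;
  amulZr : forall (k : K) (x y : A), amul x (k *: y) = k *: amul x y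
}.

#[short(type="nuAlgType")]
HB.structure Definition NUAlgebra (K : numFieldType) :=
  {A of GRing.Lmodule K A & Lmodule_hasAlgMul K A}.

HB.mixin Record NUAlgebra_isTopologicalAlgebra (K : numFieldType) A
    & Topological A & NUAlgebra K A := {
  amul_continuous : continuous (fun z : A * A => amul z.1 z.2)
}.

#[short(type="topAlgType")]
HB.structure Definition TopologicalAlgebra (K : numFieldType) :=
  {A of TopologicalLmodule K A & NUAlgebra K A
      & NUAlgebra_isTopologicalAlgebra K A}.

HB.mixin Record NUAlgebra_isSubmultiplicative (K : numFieldType) A
    & NormedModule K A & NUAlgebra K A := {
  ler_normaM : forall x y : A, `|amul x y| <= `|x| * `|y|
}.

(* The continuity of the product contained in [TopologicalAlgebra] is
   redundant here: see the factory [CompleteNormedModule_isBanachAlgebra]. *)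
#[short(type="banachAlgType")]
HB.structure Definition BanachAlgebra (K : numFieldType) :=
  {A of CompleteNormedModule K A & TopologicalAlgebra K A
      & NUAlgebra_isSubmultiplicative K A}.

HB.factory Record CompleteNormedModule_isBanachAlgebra (K : numFieldType) A
    & CompleteNormedModule K A & NUAlgebra K A := {
  ler_normaM : forall x y : A, `|amul x y| <= `|x| * `|y|
}.

HB.builders Context K A & CompleteNormedModule_isBanachAlgebra K A.

Let amulBE (x y a b : A) :
  amul a b - amul x y = amul (a - x) y + amul a (b - y).
Proof.
rewrite amulDl amulDr -(scaleN1r x) -(scaleN1r y) amulZl amulZr !scaleN1r.
by rewrite [RHS]addrC addrA subrK.
Qed.

Let amul_continuous : continuous (fun z : A * A => amul z.1 z.2).
Proof.
move=> [/= a b]; apply/cvgrPdist_lt => _/posnumP[e]; near +oo_K => M.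
near=> x y => /=; have M0 : 0 < M by [].
rewrite amulBE (le_lt_trans (ler_normD _ _))// (splitr e%:num) ltrD//.
  rewrite (le_lt_trans (ler_normaM _ _))//.
  rewrite (@le_lt_trans _ _ (`|a - x| * M)) ?ler_wpM2l -?ltr_pdivlMr//.
    by near: y; near: M; exact: cvg_bounded (@cvg_refl _ _).
  by near: x; apply: cvgr_dist_lt; rewrite // divr_gt0.
rewrite (le_lt_trans (ler_normaM _ _))//.
rewrite (@le_lt_trans _ _ (M * `|b - y|)) ?ler_wpM2r -?ltr_pdivlMl//.
by near: y; apply: cvgr_dist_lt; rewrite // mulr_gt0 ?invr_gt0.
Unshelve. all: by end_near. Qed.

HB.instance Definition _ :=
  NUAlgebra_isTopologicalAlgebra.Build K A amul_continuous.
HB.instance Definition _ :=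
  NUAlgebra_isSubmultiplicative.Build K A ler_normaM.

HB.end.

Lemma continuous_prod_topology (I : Type) (T : I -> topologicalType)
    (X : topologicalType) (f : X -> prod_topology T) :
  (forall i, continuous (fun x => f x i)) -> continuous f.
Proof.
move=> fc x; apply/cvg_sup => i.
exact: (@continuous_comp_initial _ X (T i) (fun g : forall i, T i => g i) f (fc i)).
Qed.

Lemma prod_topology_eval_continuous (I : Type) (T : I -> topologicalType) (i : I) :
  continuous (fun f : prod_topology T => f i).
Proof.
move=> f; have /cvg_sup/(_ i) fi : f --> (f : prod_topology T) by apply: cvg_id.
move=> U /(@initial_continuous _ _ (fun g : forall i, T i => g i) f) /fi.
exact.
Qed.

Section prod_zmodule.
Variables (I : Type) (T : I -> zmodType).
Implicit Types f g h : prod_topology T.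

Let padd f g : prod_topology T := fun i => f i + g i.
Let popp f : prod_topology T := fun i => - f i.
Let p0 : prod_topology T := fun=> 0.

Let paddA : associative padd.
Proof. by move=> f g h; apply: functional_extensionality_dep => i; exact: addrA. Qed.

Let paddC : commutative padd.
Proof. by move=> f g; apply: functional_extensionality_dep => i; exact: addrC. Qed.

Let padd0 : left_id p0 padd.
Proof. by move=> f; apply: functional_extensionality_dep => i; exact: add0r. Qed.

Let paddN : left_inverse p0 popp padd.
Proof. by move=> f; apply: functional_extensionality_dep => i; exact: addNr. Qed.

HB.instance Definition _ :=
  GRing.isZmodule.Build (prod_topology T) paddA paddC padd0 paddN.

End prod_zmodule.

Section prod_lmodule.
Variables (K : pzRingType) (I : Type) (T : I -> lmodType K).
Implicit Types f g h : prod_topology T.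

Let pscale k f : prod_topology T := fun i => k *: f i.

Let pscaleA k l f : pscale k (pscale l f) = pscale (k * l) f.
Proof. by apply: functional_extensionality_dep => i; exact: scalerA. Qed.

Let pscale1 : left_id 1 pscale.
Proof. by move=> f; apply: functional_extensionality_dep => i; exact: scale1r. Qed.

Let pscaleDr : right_distributive pscale +%R.
Proof. by move=> k f g; apply: functional_extensionality_dep => i; exact: scalerDr. Qed.

Let pscaleDl f : {morph pscale^~ f : k l / k + l}.
Proof. by move=> k l; apply: functional_extensionality_dep => i; exact: scalerDl. Qed.

HB.instance Definition _ := GRing.Zmodule_isLmodule.Build K (prod_topology T)
  pscaleA pscale1 pscaleDr pscaleDl.

End prod_lmodule.

Section prod_nualgebra.
Variables (K : numFieldType) (I : Type) (T : I -> nuAlgType K).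
Implicit Types f g h : prod_topology T.

Let pmul f g : prod_topology T := fun i => amul (f i) (g i).

Let pmulA : associative pmul.
Proof. by move=> f g h; apply: functional_extensionality_dep => i; exact: amulA. Qed.

Let pmulDl : left_distributive pmul +%R.
Proof. by move=> f g h; apply: functional_extensionality_dep => i; exact: amulDl. Qed.

Let pmulDr : right_distributive pmul +%R.
Proof. by move=> f g h; apply: functional_extensionality_dep => i; exact: amulDr. Qed.

Let pmulZl k f g : pmul (k *: f) g = k *: pmul f g.
Proof. by apply: functional_extensionality_dep => i; exact: amulZl. Qed.

Let pmulZr k f g : pmul f (k *: g) = k *: pmul f g.
Proof. by apply: functional_extensionality_dep => i; exact: amulZr. Qed.

HB.instance Definition _ := Lmodule_hasAlgMul.Build K (prod_topology T)
  pmulA pmulDl pmulDr pmulZl pmulZr.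

End prod_nualgebra.

Section prod_topological_algebra.
Variables (K : numFieldType) (I : Type) (T : I -> topAlgType K).
Notation P := (prod_topology T).

Let padd_continuous : continuous (fun z : P * P => z.1 + z.2).
Proof.
apply: continuous_prod_topology => i z.
apply: (@continuous2_cvg _ _ _ _ _ _ (fun z : P * P => z.1 i)
  (fun z => z.2 i) +%R).
- exact: (@add_continuous (T i) (z.1 i, z.2 i)).
- apply: (@cvg_comp _ _ _ (fun z : P * P => z.1) (fun f : P => f i)).
    exact: cvg_fst.
  exact: prod_topology_eval_continuous.
- apply: (@cvg_comp _ _ _ (fun z : P * P => z.2) (fun f : P => f i)).
    exact: cvg_snd.
  exact: prod_topology_eval_continuous.
Qed.

HB.instance Definition _ :=
  PreTopologicalNmodule_isTopologicalNmodule.Build P padd_continuous.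

Let pscale_continuous : continuous (fun z : K^o * P => z.1 *: z.2).
Proof.
apply: continuous_prod_topology => i z.
apply: (@continuous2_cvg _ _ _ _ _ _ (fun z : K^o * P => z.1)
  (fun z => z.2 i) *:%R).
- exact: (@scale_continuous K (T i) (z.1, z.2 i)).
- exact: cvg_fst.
- apply: (@cvg_comp _ _ _ (fun z : K^o * P => z.2) (fun f : P => f i)).
    exact: cvg_snd.
  exact: prod_topology_eval_continuous.
Qed.

HB.instance Definition _ :=
  TopologicalNmodule_isTopologicalLmodule.Build K P pscale_continuous.

Let pmul_continuous : continuous (fun z : P * P => amul z.1 z.2).
Proof.
apply: continuous_prod_topology => i z.
apply: (@continuous2_cvg _ _ _ _ _ _ (fun z : P * P => z.1 i)
  (fun z => z.2 i) (@amul K (T i))).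
- exact: (@amul_continuous K (T i) (z.1 i, z.2 i)).
- apply: (@cvg_comp _ _ _ (fun z : P * P => z.1) (fun f : P => f i)).
    exact: cvg_fst.
  exact: prod_topology_eval_continuous.
- apply: (@cvg_comp _ _ _ (fun z : P * P => z.2) (fun f : P => f i)).
    exact: cvg_snd.
  exact: prod_topology_eval_continuous.
Qed.

HB.instance Definition _ :=
  NUAlgebra_isTopologicalAlgebra.Build K P pmul_continuous.

End prod_topological_algebra.

Record subalgebra (K : numFieldType) (A : nuAlgType K) := Subalgebra {
  subalg_set :> set A;
  subalg0 : subalg_set 0;
  subalgD : forall x y, subalg_set x -> subalg_set y -> subalg_set (x + y);
  subalgZ : forall k x, subalg_set x -> subalg_set (k *: x);
  subalgM : forall x y, subalg_set x -> subalg_set y -> subalg_set (amul x y)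
}.

Definition subalg_type (K : numFieldType) (A : nuAlgType K) (S : subalgebra A) :
  Type := set_type S.

Section subalgebra_nualgebra.
Variables (K : numFieldType) (A : nuAlgType K) (S : subalgebra A).

HB.instance Definition _ := SubChoice.copy (subalg_type S) (set_type S).

Let S_closed : submod_closed (fun x => x \in (S : set A)).
Proof.
split=> [|k x y]; rewrite !unfold_in !inE; first exact: subalg0.
by move=> Sx Sy; apply: subalgD => //; exact: subalgZ.
Qed.

HB.instance Definition _ := GRing.SubChoice_isSubLmodule.Build K A
  (fun x => x \in (S : set A)) (subalg_type S)
  (GRing.submod_closed_semi S_closed).

Let smul_subproof (x y : subalg_type S) : amul (val x) (val y) \in (S : set A).
Proof. by rewrite inE; apply: subalgM; exact/set_mem/valP. Qed.

Let smul (x y : subalg_type S) : subalg_type S :=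
  exist (fun z => z \in (S : set A)) _ (smul_subproof x y).

Let val_smul x y : val (smul x y) = amul (val x) (val y).
Proof. by []. Qed.

Let smulA : associative smul.
Proof. by move=> x y z; apply: val_inj; exact: amulA. Qed.

Let smulDl : left_distributive smul +%R.
Proof. by move=> x y z; apply: val_inj; rewrite GRing.valD !val_smul GRing.valD amulDl. Qed.

Let smulDr : right_distributive smul +%R.
Proof. by move=> x y z; apply: val_inj; rewrite GRing.valD !val_smul GRing.valD amulDr. Qed.

Let smulZl k x y : smul (k *: x) y = k *: smul x y.
Proof. by apply: val_inj; rewrite linearZ !val_smul linearZ amulZl. Qed.

Let smulZr k x y : smul x (k *: y) = k *: smul x y.
Proof. by apply: val_inj; rewrite linearZ !val_smul linearZ amulZr. Qed.

HB.instance Definition _ := Lmodule_hasAlgMul.Build K (subalg_type S)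
  smulA smulDl smulDr smulZl smulZr.

End subalgebra_nualgebra.

Section subalgebra_topological_algebra.
Variables (K : numFieldType) (A : topAlgType K) (S : subalgebra A).
Notation W := (subalg_type S).

HB.instance Definition _ := Topological.copy W (set_type S).

Let val_continuous : continuous (val : W -> A).
Proof. exact: initial_continuous. Qed.

Let continuous_into (X : topologicalType) (f : X -> W) :
  continuous (fun x => val (f x)) -> continuous f.
Proof. exact: continuous_comp_initial. Qed.

Let sadd_continuous : continuous (fun z : W * W => z.1 + z.2).
Proof.
apply: continuous_into => z.
apply: (@continuous2_cvg _ _ _ _ _ _ (fun z : W * W => val z.1)
  (fun z => val z.2) +%R).
- exact: (@add_continuous A (val z.1, val z.2)).
- apply: (@cvg_comp _ _ _ (fun z : W * W => z.1) val); first exact: cvg_fst.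
  exact: val_continuous.
- apply: (@cvg_comp _ _ _ (fun z : W * W => z.2) val); first exact: cvg_snd.
  exact: val_continuous.
Qed.

HB.instance Definition _ :=
  PreTopologicalNmodule_isTopologicalNmodule.Build W sadd_continuous.

Let sscale_continuous : continuous (fun z : K^o * W => z.1 *: z.2).
Proof.
apply: continuous_into => z.
apply: (@continuous2_cvg _ _ _ _ _ _ (fun z : K^o * W => z.1)
  (fun z => val z.2) *:%R).
- exact: (@scale_continuous K A (z.1, val z.2)).
- exact: cvg_fst.
- apply: (@cvg_comp _ _ _ (fun z : K^o * W => z.2) val); first exact: cvg_snd.
  exact: val_continuous.
Qed.

HB.instance Definition _ :=
  TopologicalNmodule_isTopologicalLmodule.Build K W sscale_continuous.

Let smul_continuous : continuous (fun z : W * W => amul z.1 z.2).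
Proof.
apply: continuous_into => z.
apply: (@continuous2_cvg _ _ _ _ _ _ (fun z : W * W => val z.1)
  (fun z => val z.2) (@amul K A)).
- exact: (@amul_continuous K A (val z.1, val z.2)).
- apply: (@cvg_comp _ _ _ (fun z : W * W => z.1) val); first exact: cvg_fst.
  exact: val_continuous.
- apply: (@cvg_comp _ _ _ (fun z : W * W => z.2) val); first exact: cvg_snd.
  exact: val_continuous.
Qed.

HB.instance Definition _ :=
  NUAlgebra_isTopologicalAlgebra.Build K W smul_continuous.

End subalgebra_topological_algebra.

Definition alg_hom (K : numFieldType) (A B : nuAlgType K) (f : A -> B) : Prop :=
  linear f /\ {morph f : x y / amul x y}.

Definition topologically_isomorphic (K : numFieldType) (A B : topAlgType K) :
    Prop :=
  exists (f : A -> B) (g : B -> A),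
    [/\ alg_hom f, cancel f g, cancel g f, continuous f & continuous g].

Definition complemented (K : numFieldType) (A : topAlgType K)
    (S : subalgebra A) : Prop :=
  exists r : A -> subalg_type S,
    [/\ alg_hom r, continuous r & forall x : subalg_type S, r (val x) = x].

(* "X is a complemented subalgebra of A", up to topological isomorphism. *)
Definition complemented_subalgebra_of (K : numFieldType) (X A : topAlgType K) :
    Prop :=
  exists S : subalgebra A,
    complemented S /\ topologically_isomorphic X (subalg_type S).

Definition frechet_algebra (K : numFieldType) (A : topAlgType K) : Prop :=
  exists (I : Type) (B : I -> banachAlgType K)
      (S : subalgebra (prod_topology B)),
    [/\ countable [set: I], closed (S : set (prod_topology B)) &
        topologically_isomorphic A (subalg_type S)].

(* Main.v *)
Require Import Defs.
From mathcomp Require Import all_boot all_order all_algebra.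
From mathcomp Require Import all_classical all_reals all_analysis.
From mathcomp.real_closed Require Import complex.
From mathcomp Require wochoice.

Set Implicit Arguments.
Unset Strict Implicit.
Unset Printing Implicit Defensive.

Import numFieldNormedType.Exports.

Local Open Scope classical_set_scope.
Local Open Scope ring_scope.
Local Open Scope complex_scope.

Import Order.TTheory GRing.Theory Num.Theory.

(** Write [B] for the product of the [B t], and [e] for the retraction of [B]
onto the copy of [X], seen as a continuous idempotent endomorphism of [B].

Call a set [S] of indices admissible when [e x] vanishes on [S] as soon as [x]
does, i.e. when [e] induces an endomorphism of the product over [S]. Unions of
admissible sets are admissible. A continuous homomorphism from [B] to a Frechet
algebra depends on countably many coordinates only ([countable_dependence]),
so every countable set lies in a countable admissible one
([admissible_hull]). Well-order [T], choose for each [t] a countably infinite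
admissible set [A t] containing [t], and let the rank of [u] be the least [t]
with [u] in [A t]. The sets of elements of rank [< t] and of rank [<= t] are
unions of sets [A s], hence admissible, and the elements of rank [t] form a
subset of [A t] ([triangular_filtration]).

For this partition of [T] into levels, [e] is block triangular. As
homomorphisms need not preserve a unit, cutting a family off outside a level
(replacing the other coordinates by [0]) is a continuous homomorphism; so each
diagonal block [diag t] of [e] is one too, and it is idempotent because
[e] is ([diag_idem]). Its fixed points are the factor [F t], a retract of the
product over [A t], and therefore a Frechet algebra ([frechet_retract],
[frechet_prod]).

The isomorphism sends [x] to the family of the [diag t x]. A fixed point [x] of
[e] satisfies on level [t] the equation
  [x = e (x cut off to the ranks < t) + diag t x]
([fixed_solves]), which for any prescribed family of diagonal parts is a
well-founded recursion along the rank. It has exactly one solution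
([solves_exists], [solves_unique]); this solution is fixed by [e] and has the
prescribed diagonal parts ([solves_fixed], [solves_diag]), and it depends
continuously on them ([solves_continuous]). Being multiplicative then costs
nothing: the inverse of a bijective homomorphism is one.

Closed subalgebras of products are handled through closed embeddings, in a form
stated with filters that passes easily to composites, products and
retracts. *)

(** * Continuous homomorphisms *)

Section ContinuousHom.
Variable K : numFieldType.
Implicit Types A B C : topAlgType K.

Definition cont_hom A B (f : A -> B) : Prop := alg_hom f /\ continuous f.

Lemma cont_hom_comp A B C (g : B -> C) (f : A -> B) :
  cont_hom g -> cont_hom f -> cont_hom (fun x => g (f x)).
Proof.
move=> [[gl gm] gc] [[fl fm] fc]; split; first split.
- by move=> a x y; rewrite fl gl.
- by move=> x y; rewrite fm gm.
- by move=> x; apply: (@continuous_comp _ _ _ f g); [exact: fc|exact: gc].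
Qed.

Lemma cont_hom0 A B (f : A -> B) : cont_hom f -> f 0 = 0.
Proof. by move=> [[fl _] _]; have := fl (-1) 0 0; rewrite scaler0 addr0 scaleN1r addNr. Qed.

Lemma cont_homD A B (f : A -> B) : cont_hom f -> {morph f : x y / x + y}.
Proof. by move=> [[fl _] _] x y; have := fl 1 x y; rewrite !scale1r. Qed.

Lemma cont_homZ A B (f : A -> B) k x : cont_hom f -> f (k *: x) = k *: f x.
Proof.
by move=> fh; have [[fl _] _] := fh; have := fl k x 0;
  rewrite (cont_hom0 fh) !addr0.
Qed.

Lemma cont_homB A B (f : A -> B) : cont_hom f -> {morph f : x y / x - y}.
Proof.
move=> fh x y; rewrite (cont_homD fh); congr (_ + _).
by rewrite -scaleN1r (cont_homZ _ _ fh) scaleN1r.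
Qed.

Lemma amul00 (A : nuAlgType K) : amul (0 : A) 0 = 0.
Proof. by have := amulZl 0 (0 : A) 0; rewrite !scale0r. Qed.

Lemma cont_hom_zero A B : cont_hom (fun _ : A => 0 : B).
Proof.
split; last by move=> x; exact: cvg_cst.
by split => [a x y|x y]; rewrite ?scaler0 ?addr0 ?amul00.
Qed.

Lemma cont_hom_id A : cont_hom (fun x : A => x).
Proof. by split=> // x U. Qed.

Lemma cont_hom_ev (I : Type) (B : I -> topAlgType K) i :
  cont_hom (fun x : prod_topology B => x i).
Proof. by split=> //; exact: prod_topology_eval_continuous. Qed.

Lemma cont_hom_prod (I : Type) A (B : I -> topAlgType K)
    (f : A -> prod_topology B) :
  (forall i, cont_hom (fun x => f x i)) -> cont_hom f.
Proof.
move=> fh; split; last by apply: continuous_prod_topology => i; case: (fh i).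
split=> [a x y|x y]; apply: functional_extensionality_dep => i.
- by have [[+ _] _] := fh i; apply.
- by have [[_ +] _] := fh i; apply.
Qed.

Lemma cont_hom_val A (S : subalgebra A) : cont_hom (val : subalg_type S -> A).
Proof.
split; last exact: initial_continuous.
by split=> // a x y; rewrite linearP.
Qed.

Lemma cont_hom_into A B (S : subalgebra B) (f : A -> subalg_type S) :
  cont_hom (fun x => val (f x)) -> cont_hom f.
Proof.
move=> [[fl fm] fc]; split; last exact: continuous_comp_initial.
split=> [a x y|x y]; apply: val_inj; last exact: fm.
by rewrite linearP; exact: fl.
Qed.

End ContinuousHom.

(** * Closed embeddings *)

Section ClosedEmbedding.

Lemma cvg_initialP (S : choiceType) (T : topologicalType) (f : S -> T)
    (F : set_system S) (s : initial_topology f) :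
  Filter F -> F --> s <-> f @ F --> f s.
Proof.
move=> FF; split=> [Fs|fFs U /= [_ [[W oW <-] Ws WU]]].
  move=> U /(@initial_continuous _ _ f s) fU; exact: Fs.
by apply: filterS WU _; apply: fFs; exact: open_nbhs_nbhs.
Qed.

Lemma cvg_prod_topologyP (I : Type) (T : I -> topologicalType)
    (F : set_system (prod_topology T)) (y : prod_topology T) :
  Filter F -> F --> y <-> forall i, (fun f : prod_topology T => f i) @ F --> y i.
Proof.
move=> FF; split=> [Fy i|Fy].
  exact: cvg_trans (cvg_app _ Fy) (@prod_topology_eval_continuous _ _ i y).
by apply/cvg_sup => i; apply/cvg_initialP; exact: Fy.
Qed.

(** A filter on [A] whose image converges converges itself: this says at once that
the range is closed and that the topology of [A] is the induced one. *)
Definition closed_embedding (A C : topologicalType) (f : A -> C) : Prop :=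
  [/\ continuous f, injective f &
      forall (F : set_system A) (y : C), ProperFilter F -> f @ F --> y ->
        exists2 x, f x = y & F --> x].

(** The Hausdorff property, for products over index types that carry no decidable
equality. *)
Definition unique_limits (A : topologicalType) : Prop :=
  forall (F : set_system A) (x y : A), ProperFilter F ->
    F --> x -> F --> y -> x = y.

Lemma unique_limits_prod (I : Type) (T : I -> topologicalType) :
  (forall i, unique_limits (T i)) -> unique_limits (prod_topology T).
Proof.
move=> uT F x y PF /cvg_prod_topologyP Fx /cvg_prod_topologyP Fy.
by apply: functional_extensionality_dep => i; exact: uT (Fx i) (Fy i).
Qed.

Lemma unique_limits_injective (A C : topologicalType) (f : A -> C) :
  continuous f -> injective f -> unique_limits C -> unique_limits A.
Proof.
move=> fc fI uC F x y PF Fx Fy; apply: fI; apply: (uC (f @ F)).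
  exact: cvg_trans (cvg_app f Fx) (fc x).
exact: cvg_trans (cvg_app f Fy) (fc y).
Qed.

Lemma closed_embedding_comp (A C E : topologicalType) (g : C -> E) (f : A -> C) :
  closed_embedding g -> closed_embedding f -> closed_embedding (fun x => g (f x)).
Proof.
move=> [gc gI ge] [fc fI fe]; split=> [x|x y /gI/fI//|F y PF gfFy].
  by apply: (@continuous_comp _ _ _ f g); [exact: fc|exact: gc].
have [z gz /fe[x fx Fx]] := ge (f @ F) y _ gfFy.
by exists x => //; rewrite fx.
Qed.

(** The range of [i] is the set where the continuous maps [i \o r] and the
identity agree. *)
Lemma closed_embedding_retract (A C : topologicalType) (i : A -> C)
    (r : C -> A) : unique_limits C ->
  continuous i -> continuous r -> cancel i r -> closed_embedding i.
Proof.
move=> uC ic rc irK; split=> // [|F y PF iFy]; first exact: can_inj irK.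
have Fry : F --> r y.
  move=> U /rc/iFy; rewrite !nbhs_filterE /=.
  by apply: filterS => x /=; rewrite irK.
exists (r y) => //; apply: (uC (i @ F)) => //.
exact: cvg_trans (cvg_app i Fry) (ic _).
Qed.

Lemma closed_embedding_bij (A C : topologicalType) (i : A -> C) (r : C -> A) :
  continuous i -> continuous r -> cancel i r -> cancel r i ->
  closed_embedding i.
Proof.
move=> ic rc irK riK; split=> // [|F y PF iFy]; first exact: can_inj irK.
exists (r y) => // U /rc/iFy; rewrite !nbhs_filterE /=.
by apply: filterS => x /=; rewrite irK.
Qed.

Lemma closed_embedding_val (K : numFieldType) (A : topAlgType K)
    (S : subalgebra A) :
  closed (S : set A) -> closed_embedding (val : subalg_type S -> A).
Proof.
move=> cS; split; [exact: initial_continuous|exact: val_inj|].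
move=> F y PF Fy.
have Sy : (S : set A) y.
  apply: cS => U /Fy FU; have [x Ux] := @filter_ex _ _ PF _ FU.
  by exists (val x); split=> //; exact/set_mem/valP.
exists (exist _ y (mem_set Sy) : subalg_type S) => //.
by apply/cvg_initialP.
Qed.

(** Stated with the two levels of products merged into one over pairs, so that a
product of subalgebras of products of Banach algebras is a subalgebra of a
product of Banach algebras. *)
Lemma closed_embedding_prod (I : Type) (J : I -> Type)
    (T : I -> topologicalType) (V : forall i, J i -> topologicalType)
    (f : forall i, T i -> prod_topology (V i)) :
  (forall i, closed_embedding (f i)) ->
  closed_embedding (fun (x : prod_topology T) =>
     (fun p : {i & J i} => f (tag p) (x (tag p)) (tagged p))
       : prod_topology (fun p : {i & J i} => V (tag p) (tagged p))).
Proof.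
move=> fe; split.
- apply: continuous_prod_topology => -[i j] x /=.
  apply: (@continuous_comp _ _ _ (fun x : prod_topology T => f i (x i))
    (fun g : prod_topology (V i) => g j)); last exact: prod_topology_eval_continuous.
  apply: (@continuous_comp _ _ _ (fun x : prod_topology T => x i) (f i)).
    exact: prod_topology_eval_continuous.
  by have [fc _ _] := fe i; exact: fc.
- move=> x y xy; apply: functional_extensionality_dep => i.
  have [_ fI _] := fe i; apply: fI.
  apply: functional_extensionality_dep => j.
  exact: (congr1 (fun g : prod_topology (fun p : {i & J i} =>
    V (tag p) (tagged p)) => g (existT _ i j)) xy).
- move=> F y PF Fy.
  have lim i : exists x : T i, f i x = (fun j => y (existT _ i j)) /\
      (fun g : prod_topology T => g i) @ F --> x.
    have [_ _ fE] := fe i.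
    have [|x fx Fx] := fE ((fun g : prod_topology T => g i) @ F)
      (fun j => y (existT _ i j)); last by exists x.
    apply/cvg_prod_topologyP => j.
    by move/cvg_prod_topologyP : Fy => /(_ (existT _ i j)).
  have xP i := projT2 (cid (lim i)); set x := fun i => projT1 (cid (lim i)).
  exists (x : prod_topology T).
    apply: functional_extensionality_dep => -[i j] /=.
    by have [-> _] := xP i.
  by apply/cvg_prod_topologyP => i; have [_] := xP i.
Qed.

End ClosedEmbedding.

(** * Frechet algebras *)

Section Frechet.
Variable K : numFieldType.

(** Replaces the closed subalgebra by an embedding, for which there is no
subtype to transport along. *)
Lemma frechet_algebraP (A : topAlgType K) :
  frechet_algebra A <->
  exists (I : Type) (B : I -> banachAlgType K) (f : A -> prod_topology B),
    [/\ countable [set: I], cont_hom f & closed_embedding f].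
Proof.
split=> [[I [B [S [cI cS [f [g [fm fK gK fc gc]]]]]]]|[I [B [f [cI fh fe]]]]].
  exists I, B, (fun x => val (f x)); split => //.
    by apply: (cont_hom_comp (cont_hom_val S)); split.
  apply: (closed_embedding_comp (closed_embedding_val cS)).
  exact: closed_embedding_bij fc gc fK gK.
have [fc fI flim] := fe; have [[fl fm] _] := fh.
have r0 : range f 0 by exists 0 => //; exact: cont_hom0 fh.
have rD x y : range f x -> range f y -> range f (x + y).
  by move=> [a _ <-] [b _ <-]; exists (a + b) => //; exact: cont_homD fh _ _.
have rZ k x : range f x -> range f (k *: x).
  by move=> [a _ <-]; exists (k *: a) => //; exact: cont_homZ fh.
have rM x y : range f x -> range f y -> range f (amul x y).
  by move=> [a _ <-] [b _ <-]; exists (amul a b) => //; exact: fm.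
pose S := Subalgebra r0 rD rZ rM.
pose f' (x : A) : subalg_type S := exist _ (f x) (mem_set (imageT f x)).
have gP (w : subalg_type S) : exists x, f x = val w.
  by have [x _ <-] := set_mem (valP w); exists x.
pose g w := projT1 (cid (gP w)).
have fg w : f (g w) = val w by exact: projT2 (cid (gP w)).
have fK : cancel f' g by move=> x; apply: fI; rewrite fg.
have gK : cancel g f' by move=> w; apply: val_inj; exact: fg.
have [f'm f'c] : cont_hom f' by apply: cont_hom_into.
exists I, B, S; split => //.
  move=> y cly.
  (* The neighbourhoods of [y] pulled back along [f]: it is because [y] is
     adherent to the range that they generate a proper filter. *)
  have PF : ProperFilter (filter_from (nbhs y) (fun U => f @^-1` U)).
    apply: filter_from_proper.
      apply: filter_from_filter; first by exists setT; exact: filterT.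
      by move=> U V yU yV; exists (U `&` V) => //; exact: filterI.
    by move=> U /cly [_ [[x _ <-] Ux]]; exists x.
  have [|x <- _] := flim _ y PF; last by exists x.
  by move=> U yU; exists U.
exists f', g; split=> // w.
have Fw : f @ (g @ nbhs w) --> val w.
  move=> U /(@initial_continuous _ _ (val : set_type S -> _) w).
  by rewrite !nbhs_filterE /=; apply: filterS => v /=; rewrite fg.
have [x fx Fx] := flim (g @ nbhs w) (val w) _ Fw.
have gx : g w = x by apply: fI; rewrite fg fx.
by move: Fx; rewrite -gx.
Qed.

Lemma unique_limits_frechet (A : topAlgType K) :
  frechet_algebra A -> unique_limits A.
Proof.
move=> /frechet_algebraP[I [B [f [_ _ [fc fI _]]]]].
apply: (unique_limits_injective fc fI); apply: unique_limits_prod => i F x y PF.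
exact: (cvg_unique (@norm_hausdorff _ (B i))).
Qed.

Lemma frechet_prod (I : Type) (A : I -> topAlgType K) :
  countable [set: I] -> (forall i, frechet_algebra (A i)) ->
  frechet_algebra (prod_topology A).
Proof.
move=> cI fA.
have [J JP] := choice (fun i => (frechet_algebraP (A i)).1 (fA i)).
have BP i := cid (JP i).
pose B i := projT1 (BP i).
have fP i := cid (projT2 (BP i)).
pose f i := projT1 (fP i).
have fE i : [/\ countable [set: J i], cont_hom (f i) & closed_embedding (f i)].
  exact: projT2 (fP i).
apply/frechet_algebraP.
exists {i & J i}, (fun p => B (tag p) (tagged p)),
  (fun x p => f (tag p) (x (tag p)) (tagged p)); split.
- have injT (X : Type) : countable [set: X] -> exists g : X -> nat, injective g.
    by move=> /countable_injP[g gI]; exists g => x y; apply: gI; rewrite inE.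
  have [a aI] := injT _ cI.
  have bP i : exists g : J i -> nat, injective g.
    by apply: injT; have [] := fE i.
  pose b i := projT1 (cid (bP i)).
  have bI i : injective (b i) := projT2 (cid (bP i)).
  apply/countable_injP.
  exists (fun p => pickle (a (tag p), b (tag p) (tagged p))).
  move=> [i j] [i' j'] _ _ /(pcan_inj pickleK) [/= /aI ii'].
  by case: _ / ii' j' => j' /bI ->.
- apply: cont_hom_prod => -[i j] /=.
  have [_ fh _] := fE i.
  exact: (cont_hom_comp (cont_hom_ev _ j) (cont_hom_comp fh (cont_hom_ev _ i))).
- by apply: (@closed_embedding_prod I J A B f) => i; have [] := fE i.
Qed.

Lemma frechet_retract (A C : topAlgType K) (i : A -> C) (r : C -> A) :
  cont_hom i -> continuous r -> cancel i r ->
  frechet_algebra C -> frechet_algebra A.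
Proof.
move=> ih rc irK fC; have uC := unique_limits_frechet fC.
have /frechet_algebraP[I [B [f [cI fh fe]]]] := fC.
apply/frechet_algebraP; exists I, B, (fun x => f (i x)); split=> //.
  exact: cont_hom_comp fh ih.
apply: closed_embedding_comp fe _.
by have [_ ic] := ih; exact: closed_embedding_retract ic rc irK.
Qed.

(** The families vanishing on larger and larger finite sets of coordinates
converge to [0], so on one such subspace [f] takes values in the open unit
ball; a subspace with this property is sent to [0]. *)
Lemma finite_dependence (I : Type) (B : I -> topAlgType K)
    (V : banachAlgType K) (f : prod_topology B -> V) :
  cont_hom f ->
  exists2 D : set I, finite_set D &
    forall x : prod_topology B, (forall i, D i -> x i = 0) -> f x = 0.
Proof.
move=> fh; pose Z (D : set I) : set (prod_topology B) :=
  [set x | forall i, D i -> x i = 0].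
pose G := filter_from (@finite_set I) Z.
have FG : Filter G.
  apply: filter_from_filter; first by exists set0; exact: finite_set0.
  move=> D E fD fE; exists (D `|` E); first by rewrite finite_setU.
  by move=> x xZ; split=> i ?; apply: xZ; [left|right].
have G0 : G --> (0 : prod_topology B).
  apply/cvg_prod_topologyP => i U /nbhs_singleton U0.
  exists [set i]; first exact: finite_set1.
  by move=> x /(_ i erefl) /= ->.
have : f @ G --> (0 : V).
  by have [_ fc] := fh; rewrite -(cont_hom0 fh); exact: cvg_trans (cvg_app f G0) (fc _).
move=> /cvgrPdist_lt /(_ 1 ltr01)[D fD DP].
exists D => // x xD; apply/eqP; apply: contraT => fx0.
(* Rescaling [x] so that its image has norm [1] leaves the unit ball. *)
have : `|f (`|f x|^-1 *: x)| < 1.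
  rewrite -normrN -[- _]add0r; apply: DP => i Di /=.
  by rewrite -[LHS]/(`|f x|^-1 *: x i) xD // scaler0.
by rewrite (cont_homZ _ _ fh) normrZ normfV normr_id mulVf ?normr_eq0 // ltxx.
Qed.

Lemma countable_dependence (I : Type) (B : I -> topAlgType K)
    (V : topAlgType K) (f : prod_topology B -> V) :
  frechet_algebra V -> cont_hom f ->
  exists2 D : set I, countable D &
    forall x : prod_topology B, (forall i, D i -> x i = 0) -> f x = 0.
Proof.
move=> /frechet_algebraP[J [C [g [cJ gh [_ gI _]]]]] fh.
have fin j : exists D : set I, finite_set D /\
    forall x : prod_topology B, (forall i, D i -> x i = 0) -> g (f x) j = 0.
  have [|D fD DP] := @finite_dependence I B (C j) (fun x => g (f x) j).
    exact: (cont_hom_comp (cont_hom_ev _ j) (cont_hom_comp gh fh)).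
  by exists D.
have [D DP] := choice fin.
exists (\bigcup_j D j).
  by apply: bigcup_countable => // j _; apply: finite_set_countable; have [] := DP j.
move=> x xD; apply: gI; apply: functional_extensionality_dep => j.
rewrite (cont_hom0 gh); have [_ ->//] := DP j.
by move=> i Dji; apply: xD; exists j.
Qed.

End Frechet.

(** * Cutting families off *)

Section CoordinateMasks.
Variables (K : numFieldType) (T : Type) (B : T -> topAlgType K).
Implicit Types (P : set T) (x y : prod_topology B).

Definition mask P x : prod_topology B := fun t => if pselect (P t) then x t else 0.

Lemma maskT P x t : P t -> mask P x t = x t.
Proof. by rewrite /mask; case: pselect. Qed.

Lemma maskF P x t : ~ P t -> mask P x t = 0.
Proof. by rewrite /mask; case: pselect. Qed.

Lemma cont_hom_mask P : cont_hom (mask P).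
Proof.
apply: cont_hom_prod => t; rewrite /mask.
by case: (pselect (P t)) => ?; [exact: cont_hom_ev|exact: cont_hom_zero].
Qed.

Lemma mask_outside P (Q : set T) x : P `<=` Q -> mask Q (mask P x) = mask P x.
Proof.
move=> PQ; apply: functional_extensionality_dep => t.
have [Qt|nQt] := pselect (Q t); first by rewrite maskT.
by rewrite !maskF // => /PQ.
Qed.

Lemma mask_inside P (Q : set T) x : P `<=` Q -> mask P (mask Q x) = mask P x.
Proof.
move=> PQ; apply: functional_extensionality_dep => t.
have [Pt|nPt] := pselect (P t); last by rewrite !maskF.
by rewrite !maskT //; exact: PQ.
Qed.

Lemma mask_mask P x : mask P (mask P x) = mask P x.
Proof. exact: mask_inside. Qed.

Definition restrict P x : prod_topology (fun t : P => B (val t)) :=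
  fun t => x (val t).

Definition extend0 P (y : prod_topology (fun t : P => B (val t))) :
    prod_topology B :=
  fun t => if pselect (P t) is left Pt then y (exist _ t (mem_set Pt)) else 0.

Lemma cont_hom_restrict P : cont_hom (@restrict P).
Proof. by apply: cont_hom_prod => t; exact: cont_hom_ev. Qed.

Lemma cont_hom_extend0 P : cont_hom (@extend0 P).
Proof.
apply: cont_hom_prod => t; rewrite /extend0; case: (pselect (P t)) => [Pt|?].
  exact: (cont_hom_ev _ (exist _ t (mem_set Pt) : P)).
exact: cont_hom_zero.
Qed.

Lemma extend0_restrict P x : extend0 (restrict (P := P) x) = mask P x.
Proof.
by apply: functional_extensionality_dep => t; rewrite /extend0 /mask;
  case: pselect.
Qed.

Lemma restrict_extend0 P (y : prod_topology (fun t : P => B (val t))) :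
  restrict (extend0 y) = y.
Proof.
apply: functional_extensionality_dep => -[t Pt]; rewrite /restrict /extend0 /=.
case: pselect => [Pt'|nPt]; last by case: nPt; exact: set_mem Pt.
by congr (y (exist _ _ _)); exact: bool_irrelevance.
Qed.

End CoordinateMasks.

(** * Admissible sets of coordinates *)

Section Admissible.
Variables (K : numFieldType) (T : Type) (B : T -> topAlgType K).
Variable e : prod_topology B -> prod_topology B.
Implicit Types (S : set T) (x y : prod_topology B).

Definition admissible S : Prop := forall x,
  (forall t, S t -> x t = 0) -> forall t, S t -> e x t = 0.

Lemma admissible_bigcup (I : Type) (D : set I) (S : I -> set T) :
  (forall i, D i -> admissible (S i)) -> admissible (\bigcup_(i in D) S i).
Proof.
move=> aS x x0 t [i Di Sit]; apply: (aS i Di x) => // s Sis.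
by apply: x0; exists i.
Qed.

Hypothesis eh : cont_hom e.

Lemma admissible_eq S x y : admissible S ->
  (forall t, S t -> x t = y t) -> forall t, S t -> e x t = e y t.
Proof.
move=> aS xy t St; apply/eqP; rewrite -subr_eq0; apply/eqP.
have := aS (x - y) _ t St; rewrite (cont_homB eh); apply=> s Ss.
by rewrite -[LHS]/(x s - y s) xy // subrr.
Qed.

(** Close [C] under adding, for each index [t] already present, countably many
indices that determine the coordinate [t] of [e]. *)
Lemma admissible_hull (C : set T) : (forall t, frechet_algebra (B t)) ->
  countable C -> exists A, [/\ countable A, C `<=` A & admissible A].
Proof.
move=> fB cC.
have dep t : exists N, countable N /\ forall x, (forall s, N s -> x s = 0) -> e x t = 0.
  have [N cN NP] := countable_dependence (fB t) (cont_hom_comp (cont_hom_ev _ t) eh).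
  by exists N.
have [N NP] := choice dep.
pose A n := iter n (fun S => \bigcup_(t in S) N t) C.
exists (\bigcup_n A n); split.
- apply: bigcup_countable => // n _; elim: n => [//|n IHn] /=.
  by apply: bigcup_countable => // t _; have [] := NP t.
- by move=> t Ct; exists 0%N.
- move=> x x0 t [n _ Ant]; have [_ +] := NP t; apply=> s Nts.
  by apply: x0; exists n.+1 => //; exists t.
Qed.

End Admissible.

(** * A filtration by admissible sets *)

(** The well-ordering principle, as a strict order for which Noetherian
induction and recursion are available. *)
Lemma well_founded_order (T : Type) : exists lt : T -> T -> Prop,
  [/\ well_founded lt, forall x y z, lt x y -> lt y z -> lt x z &
      forall A : set T, A !=set0 ->
        exists2 z, A z & forall x, A x -> x = z \/ lt z x].
Proof.
have [R Rwo] := wochoice.well_ordering_principle {classic T}.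
have min (A : set T) : A !=set0 -> exists2 z, A z & forall x, A x -> R z x.
  move=> [a Aa]; have [|z [[zA zmin] _]] := Rwo [pred x : {classic T} | `[< A x >]].
    by exists a; exact/asboolP.
  exists z; first exact/asboolP.
  by move=> x Ax; apply: zmin; exact/asboolP.
have anti x y : R x y -> R y x -> x = y.
  move=> xy yx; have [|z [_ zU]] := Rwo (pred2 x y).
    by exists x; rewrite inE /= eqxx.
  have rr u : R u u.
    by have [|v -> /(_ u erefl)] := min [set u]; first by exists u.
  have xm : wochoice.minimum_of R (pred2 x y) x.
    by split=> [|u]; rewrite !inE ?eqxx // => /orP[] /eqP ->.
  have ym : wochoice.minimum_of R (pred2 x y) y.
    by split=> [|u]; rewrite !inE ?eqxx ?orbT // => /orP[] /eqP ->.
  by rewrite -(zU _ xm) (zU _ ym).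
exists (fun x y => ~ R y x); split.
- move=> x; apply: contrapT => nx.
  have [|z nz zmin] := min [set x | ~ Acc (fun x y => ~ R y x) x]; first by exists x.
  apply: nz; constructor=> y nzy; apply: contrapT => ny.
  by apply: nzy; exact: zmin.
- move=> x y z nyx nzy zx.
  have [|m mE mmin] := min [set u | [\/ u = x, u = y | u = z]].
    by exists x; exact: Or31.
  have xz := mmin z (Or33 _ _ erefl); have xx := mmin x (Or31 _ _ erefl).
  have xy := mmin y (Or32 _ _ erefl).
  case: mE => mE; subst m => //.
  by apply: nzy; rewrite (anti _ _ zx xz).
- move=> A /min[z Az zmin]; exists z => // x Ax.
  have [xz|] := pselect (R x z); last by right.
  by left; exact: anti xz (zmin x Ax).
Qed.

(** * Block triangular idempotents *)

Section TriangularDecomposition.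
Variables (K : numFieldType) (T : Type) (B : T -> topAlgType K).
Variable e : prod_topology B -> prod_topology B.
Hypotheses (eh : cont_hom e) (eK : forall x, e (e x) = e x).
Variables (J : Type) (lt : J -> J -> Prop) (rank : T -> J).
Hypothesis lt_wf : well_founded lt.
Implicit Types (x y : prod_topology B) (t : J) (u v : T).

Definition below t : set T := [set u | lt (rank u) t].
Definition level t : set T := [set u | rank u = t].

Hypothesis below_adm : forall t, admissible e (below t).
Hypothesis upto_adm : forall t, admissible e (below t `|` level t).

(** The diagonal block of [e] at the level [t], extended by [0] to all
coordinates. *)
Definition diag t x : prod_topology B := mask (level t) (e (mask (level t) x)).

Lemma cont_hom_diag t : cont_hom (diag t).
Proof.
exact (cont_hom_comp (cont_hom_mask _ (level t))
  (cont_hom_comp eh (cont_hom_mask _ (level t)))).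
Qed.

Lemma lt_irr t : ~ lt t t.
Proof. by elim: (lt_wf t) => {}t _ IH ltt; exact: (IH _ ltt ltt). Qed.

Lemma belowNlevel t u : below t u -> ~ level t u.
Proof. by rewrite /below /level /= => + E; rewrite E; exact: lt_irr. Qed.

(** On the ranks up to [t], which form an admissible set, [x] is the sum of its two
cut off parts. *)
Lemma split_level t x u : level t u ->
  e x u = e (mask (below t) x) u + e (mask (level t) x) u.
Proof.
move=> tu.
have -> : e (mask (below t) x) u + e (mask (level t) x) u =
          e (mask (below t) x + mask (level t) x) u by rewrite (cont_homD eh).
apply: (admissible_eq eh (@upto_adm t)); last by right.
move=> v [vb|vl]; rewrite -[RHS]/(mask (below t) x v + mask (level t) x v).
  by rewrite maskT // maskF ?addr0 //; exact: belowNlevel.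
by rewrite maskF ?maskT ?add0r //; move/belowNlevel; exact.
Qed.

Lemma level_below t x u : below t u -> e (mask (level t) x) u = 0.
Proof. by apply: below_adm => v vb; rewrite maskF //; exact: belowNlevel. Qed.

(** The cut off family [mask (level t) x] and its image under [e] both vanish
below [t]; so [diag t x] agrees with that image on all ranks up to [t], and
idempotence of [e] concludes. *)
Lemma e_diag t x u : level t u -> e (diag t x) u = e (mask (level t) x) u.
Proof.
move=> tu; rewrite -[RHS](congr1 (fun w : prod_topology B => w u) (eK _)).
apply: (admissible_eq eh (@upto_adm t)); last by right.
move=> v [vb|vl]; rewrite /diag; last by rewrite maskT.
by rewrite level_below // maskF //; exact: belowNlevel.
Qed.

Lemma diag_idem t x : diag t (diag t x) = diag t x.
Proof.
rewrite {1}/diag [mask _ (diag t x)]mask_mask.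
apply: functional_extensionality_dep => u.
have [tu|tu] := pselect (level t u); last by rewrite /diag !maskF.
by rewrite maskT // e_diag // /diag maskT.
Qed.

(** The recursion that rebuilds a fixed point of [e] from its diagonal parts
[z]. *)
Definition solves (z : J -> prod_topology B) x : Prop :=
  forall u, x u = e (mask (below (rank u)) x) u + z (rank u) u.

Lemma fixed_solves x : e x = x -> solves (fun t => diag t x) x.
Proof.
move=> ex u; rewrite -{1}ex (@split_level (rank u)) //.
by rewrite {1}/diag maskT.
Qed.

Lemma rank_ind (P : T -> Prop) :
  (forall u, (forall v, lt (rank v) (rank u) -> P v) -> P u) -> forall u, P u.
Proof.
move=> IH u; have [t tE] : exists t, t = rank u by exists (rank u).
elim: (lt_wf t) u tE => {}t _ IHt u tE; apply: IH => v vu.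
by apply: IHt erefl; rewrite tE.
Qed.

Lemma solves_unique z x y : solves z x -> solves z y -> x = y.
Proof.
move=> xz yz; apply: functional_extensionality_dep; apply: rank_ind => u IH.
rewrite xz yz; congr (e _ u + _); apply: functional_extensionality_dep => v.
have [vb|vb] := pselect (below (rank u) v); last by rewrite !maskF.
by rewrite !maskT //; exact: IH.
Qed.

Lemma solves_exists z : exists x, solves z x.
Proof.
have wf : well_founded (fun v u => lt (rank v) (rank u)).
  by apply: rank_ind => u IH; constructor.
pose body u (rec : forall v, lt (rank v) (rank u) -> B v) : B u :=
  e (fun v => if pselect (lt (rank v) (rank u)) is left h then rec v h else 0) u
  + z (rank u) u.
exists (Fix wf _ body) => u; rewrite Fix_eq => [|{}u f g fg]; rewrite /body.
  congr (e _ u + _); apply: functional_extensionality_dep => v.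
  by rewrite /mask /below /=; case: pselect.
congr (e _ u + _); apply: functional_extensionality_dep => v.
by case: pselect => // h; exact: fg.
Qed.

(** By induction on the rank. If [e x = x] holds on the ranks below [t], then
[x = e (mask (below t) x) + z t] on all ranks up to [t]: on the level [t] this is
the recursion, and below it [z t] vanishes while [e x] depends only on the values
of [x] there. Since [e] is idempotent and [e (z t) = z t] on the level [t],
applying [e] to the right-hand side does not change it there. *)
Lemma solves_fixed z x : (forall t, diag t (z t) = z t) -> solves z x ->
  e x = x.
Proof.
move=> zd xz; apply: functional_extensionality_dep; apply: rank_ind => u IH.
have zlevel t : z t = mask (level t) (z t) by rewrite -zd mask_mask.
have ezu : e (z (rank u)) u = z (rank u) u.
  by rewrite [in LHS]zlevel -[in RHS]zd /diag maskT.
transitivity (e (e (mask (below (rank u)) x) + z (rank u)) u); last first.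
  by rewrite (cont_homD eh) eK [RHS]xz -ezu.
apply: (admissible_eq eh (@upto_adm (rank u))); last by right.
move=> v; rewrite -[x in _ -> _ = x]/(e (mask (below (rank u)) x) v + z (rank u) v).
move=> [vb|<-]; last exact: xz.
rewrite zlevel maskF ?addr0; last exact: belowNlevel.
rewrite -IH //; apply: (admissible_eq eh (@below_adm (rank u))) => // w wb.
by rewrite maskT.
Qed.

Lemma solves_diag z x t : (forall t, diag t (z t) = z t) -> solves z x ->
  diag t x = z t.
Proof.
move=> zd xz; have ex := solves_fixed zd xz.
apply: functional_extensionality_dep => u.
have [tu|tu] := pselect (level t u); last by rewrite -zd /diag !maskF.
have := split_level x tu; rewrite ex /diag maskT // => xE.
have := xz u; rewrite tu xE; exact: addrI.
Qed.

(** Coordinate by coordinate along the rank: the recursion expresses a coordinate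
of [x] by those of smaller rank and by a coordinate of [z]. *)
Lemma solves_continuous (A : topologicalType) (z : A -> J -> prod_topology B)
    (x : A -> prod_topology B) :
  (forall t, continuous (fun w => z w t)) -> (forall w, solves (z w) (x w)) ->
  continuous x.
Proof.
move=> zc xz; apply: continuous_prod_topology; apply: rank_ind => u IH.
have -> : (fun w => x w u) = (fun w =>
    e (mask (below (rank u)) (x w)) u + z w (rank u) u).
  by apply/funext => w; exact: xz.
have evc := @prod_topology_eval_continuous _ B u.
have mc : continuous (fun w => mask (below (rank u)) (x w)).
  apply: continuous_prod_topology => v; rewrite /mask.
  by case: (pselect (below _ v)) => [vb|?]; [exact: IH|move=> w; exact: cvg_cst].
have [_ ec] := eh.
have emc : continuous (fun w => e (mask (below (rank u)) (x w)) u).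
  move=> w; apply: (@continuous_comp _ _ _ (fun w => e (mask (below (rank u)) (x w)))
    (fun y : prod_topology B => y u)); last exact: evc.
  by apply: (@continuous_comp _ _ _ _ e); [exact: mc|exact: ec].
have zuc : continuous (fun w => z w (rank u) u).
  move=> w; apply: (@continuous_comp _ _ _ (fun w => z w (rank u))
    (fun y : prod_topology B => y u)); [exact: zc|exact: evc].
move=> w; apply: (@continuous2_cvg _ _ _ _ _ _ _ _ +%R).
- exact: (@add_continuous (B u) (e (mask (below (rank u)) (x w)) u, z w (rank u) u)).
- exact: emc.
- exact: zuc.
Qed.

End TriangularDecomposition.

(** * Fixed points of a continuous idempotent homomorphism *)

Section FixedSubalgebra.
Variables (K : numFieldType) (A : topAlgType K) (q : A -> A).
Hypotheses (qh : cont_hom q) (qK : forall x, q (q x) = q x).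

Let fix0 : [set x | q x = x] 0.
Proof. exact: cont_hom0. Qed.

Let fixD x y : [set x | q x = x] x -> [set x | q x = x] y ->
  [set x | q x = x] (x + y).
Proof. by move=> /= qx qy; rewrite (cont_homD qh) qx qy. Qed.

Let fixZ k x : [set x | q x = x] x -> [set x | q x = x] (k *: x).
Proof. by move=> /= qx; rewrite (cont_homZ _ _ qh) qx. Qed.

Let fixM x y : [set x | q x = x] x -> [set x | q x = x] y ->
  [set x | q x = x] (amul x y).
Proof. by move=> /= qx qy; have [[_ qm] _] := qh; rewrite qm qx qy. Qed.

Definition fixed_subalgebra : subalgebra A := Subalgebra fix0 fixD fixZ fixM.

Definition fixed_retraction (x : A) : subalg_type fixed_subalgebra :=
  exist _ (q x) (mem_set (qK x : (fixed_subalgebra : set A) (q x))).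

Lemma val_fixed_retraction x : val (fixed_retraction x) = q x.
Proof. by []. Qed.

Lemma fixed_subalgebraE (x : subalg_type fixed_subalgebra) : q (val x) = val x.
Proof. exact: (set_mem (valP x)). Qed.

Lemma cont_hom_fixed_retraction : cont_hom fixed_retraction.
Proof. exact: cont_hom_into. Qed.

Lemma fixed_retractionK : cancel val fixed_retraction.
Proof. by move=> x; apply: val_inj; exact: fixed_subalgebraE. Qed.

Lemma fixed_subalgebra_complemented :
  complemented_subalgebra_of (subalg_type fixed_subalgebra) A.
Proof.
exists fixed_subalgebra; split.
  exists fixed_retraction; split; [| |exact: fixed_retractionK].
  - by case: cont_hom_fixed_retraction.
  - by case: cont_hom_fixed_retraction.
by exists id, id; split=> // x; exact: cvg_id.
Qed.

End FixedSubalgebra.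

(** * The decomposition *)

Lemma infinite_has_countable_subset (T : Type) : infinite_set [set: T] ->
  exists C : set T, countable C /\ infinite_set C.
Proof.
move=> /infiniteP/card_leP[f].
pose g (n : nat) : T := val (f (exist _ n (mem_set I))).
have gI : injective g.
  move=> m n /val_inj/(@inj _ _ _ f) E.
  have /(congr1 val) := E (mem_set I) (mem_set I).
  exact.
exists (range g); have gE : (range g #= [set: nat])%card.
  by apply: inj_card_eq => x y _ _; exact: gI.
split; first by rewrite (eq_countable gE).
by rewrite (eq_finite_set gE); exact: infinite_nat.
Qed.

(** The sets [A t] are made to contain a fixed infinite countable set, as
the levels alone may be finite, or empty. *)
Lemma triangular_filtration (K : numFieldType) (T : Type)
    (B : T -> topAlgType K) (e : prod_topology B -> prod_topology B) :
  ~ countable [set: T] -> (forall t, frechet_algebra (B t)) -> cont_hom e ->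
  exists (lt : T -> T -> Prop) (rank : T -> T) (A : T -> set T),
    [/\ well_founded lt, forall t, admissible e (below lt rank t),
        forall t, admissible e (below lt rank t `|` level rank t),
        forall t, (A t #= [set: nat])%card & forall t, level rank t `<=` A t].
Proof.
move=> ucT fB eh.
have [|C [cC iC]] := @infinite_has_countable_subset T.
  by move=> /finite_set_countable.
have hull t : exists A, [/\ countable A, t |` C `<=` A & admissible e A].
  apply: (admissible_hull eh fB); rewrite -bigcup2E.
  by apply: bigcup_countable => // -[|[|n]] _ //=; exact: countable1.
have [A AP] := choice hull.
have [lt [lt_wf lt_trans lt_min]] := well_founded_order T.
have rankP u : exists s, A s u /\ forall s', A s' u -> s' = s \/ lt s s'.
  have [|s As smin] := lt_min [set s | A s u]; last by exists s.
  by exists u; have [_ + _] := AP u; apply; left.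
have [rank rP] := choice rankP.
have belowE t : below lt rank t = \bigcup_(s in [set s | lt s t]) A s.
  apply/seteqP; split=> u /=.
    by move=> ut; exists (rank u) => //; have [] := rP u.
  move=> [s st Asu]; have [_ /(_ s Asu)[sE|us]] := rP u.
    by rewrite /below /= -sE.
  exact: lt_trans us st.
exists lt, rank, A; split=> //.
- by move=> t; rewrite belowE; apply: admissible_bigcup => s _; have [] := AP s.
- move=> t; have -> : below lt rank t `|` level rank t =
      \bigcup_(s in [set s | lt s t \/ s = t]) A s.
    rewrite belowE; apply/seteqP; split=> u /=.
      move=> [[s st Asu]|<-]; first by exists s => //; left.
      by exists (rank u); [right|have [] := rP u].
    move=> [s [st|->] Asu]; first by left; exists s.
    have [_ /(_ t Asu)[tE|us]] := rP u; first by right.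
    by left; exists (rank u) => //; have [] := rP u.
  by apply: admissible_bigcup => s _; have [] := AP s.
- move=> t; have [cA CA _] := AP t; apply: eq_card_nat => //.
  by apply: sub_infinite_set iC => u Cu; apply: CA; right.
- by move=> t u <-; have [] := rP u.
Qed.

Theorem theorem4p2 (R : realType) (T : Type) (B : T -> topAlgType R[i])
    (X : topAlgType R[i])
    (uncountableT : ~ countable [set: T])
    (frechetB : forall t : T, frechet_algebra (B t))
    (complX : complemented_subalgebra_of X (prod_topology B)) :
  exists (J : Type) (F : J -> topAlgType R[i]) (T_ : J -> set T),
    (forall j : J,
      [/\ frechet_algebra (F j),
          (T_ j #= [set: nat])%card &
          complemented_subalgebra_of (F j)
            (prod_topology (fun t : T_ j => B (val t)))]) /\
    topologically_isomorphic X (prod_topology F).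
Proof.
have [S [[r [rm rc rS]] [f [g [fm fK gK fc gc]]]]] := complX.
pose e (x : prod_topology B) : prod_topology B := val (r x).
have eh : cont_hom e by exact (cont_hom_comp (cont_hom_val S) (conj rm rc)).
have eK x : e (e x) = e x by rewrite /e rS.
have [lt [rank [A [lt_wf badm uadm cA levelA]]]] :=
  triangular_filtration uncountableT frechetB eh.
pose d t := diag e rank t.
have dh t : cont_hom (d t) by exact: cont_hom_diag.
have mask_d t x : mask (A t) (d t x) = d t x.
  exact: mask_outside (levelA t).
have d_mask t x : d t (mask (A t) x) = d t x.
  by rewrite /d /diag (mask_inside _ (levelA t)).
(* The diagonal block as an endomorphism of the product over [A t]. *)
pose q t (y : prod_topology (fun u : A t => B (val u))) :
    prod_topology (fun u : A t => B (val u)) := restrict (d t (extend0 y)).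
have qh t : cont_hom (q t).
  exact (cont_hom_comp (cont_hom_restrict _ (A t))
    (cont_hom_comp (dh t) (cont_hom_extend0 _ (A t)))).
have dd t x : d t (d t x) = d t x by exact: diag_idem.
have qK t y : q t (q t y) = q t y.
  by rewrite /q extend0_restrict mask_d dd.
pose F t : topAlgType R[i] := subalg_type (fixed_subalgebra (qh t)).
exists T, F, A; split=> [t|].
  split=> //; last exact (fixed_subalgebra_complemented (qh t) (qK t)).
  apply: (frechet_retract (cont_hom_val _) _ (fixed_retractionK (qK t))).
    by have [] := cont_hom_fixed_retraction (qh t) (qK t).
  apply: frechet_prod => [|u]; last exact: frechetB.
  rewrite (eq_countable (card_setT _)) (eq_countable (cA t)).
  exact: countableP.
pose z (w : prod_topology F) t : prod_topology B := extend0 (val (w t)).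
have zh t : cont_hom (fun w => z w t).
  exact (cont_hom_comp (cont_hom_extend0 _ (A t))
    (cont_hom_comp (cont_hom_val _) (cont_hom_ev _ t))).
have zd w t : d t (z w t) = z w t.
  rewrite /z -{2}(fixed_subalgebraE (w t)) /q extend0_restrict.
  by rewrite mask_d.
pose sol w := projT1 (cid (solves_exists e rank lt_wf (z w))).
have solP w : solves e lt rank (z w) (sol w) :=
  projT2 (cid (solves_exists e rank lt_wf (z w))).
have efix w : e (sol w) = sol w.
  exact (solves_fixed eh eK lt_wf badm uadm (zd w) (solP w)).
have solc : continuous sol.
  apply: (solves_continuous eh lt_wf _ solP) => t.
  by have [] := zh t.
pose Phi (x : X) : prod_topology F := fun t =>
  fixed_retraction (qh t) (qK t) (restrict (val (f x))).
have zPhi x : z (Phi x) = fun t => d t (val (f x)).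
  apply/funext => t; rewrite /z /Phi val_fixed_retraction /q.
  by rewrite !extend0_restrict d_mask mask_d.
have fh : cont_hom f by [].
have Phih : cont_hom Phi.
  apply: cont_hom_prod => t.
  exact (cont_hom_comp (cont_hom_fixed_retraction (qh t) (qK t))
    (cont_hom_comp (cont_hom_restrict _ (A t))
      (cont_hom_comp (cont_hom_val S) fh))).
have [Phim Phic] := Phih.
exists Phi, (fun w => g (r (sol w))); split=> // [x|w|].
- have <- : val (f x) = sol (Phi x); last by rewrite rS fK.
  apply: (solves_unique lt_wf _ (solP (Phi x))); rewrite zPhi.
  by apply: (fixed_solves eh lt_wf uadm); rewrite /e rS.
- apply: functional_extensionality_dep => t; apply: val_inj.
  rewrite /Phi val_fixed_retraction /q extend0_restrict d_mask gK.
  rewrite -/(e (sol w)) efix /d.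
  rewrite (solves_diag eh eK lt_wf badm uadm t (zd w) (solP w)).
  exact: restrict_extend0.
- move=> w; apply: (@continuous_comp _ _ _ (fun w => r (sol w)) g); last exact: gc.
  by apply: (@continuous_comp _ _ _ sol r); [exact: solc|exact: rc].
Qed.
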